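(* Let $\beta>0$, $\beta\ne 1$, and let $G$, its local labeling, circuits $C_1,\dots,C_m$, $G_C=(\mathcal{C},E_C)$, $A,D$ be as in the context. Suppose either $\beta>1$ and the system $X_u\oplus X_v=\mathbf{I}(A(u,v)<D(u,v))$ for all $\{u,v\}\in E_C$ has a solution over $\mathrm{GF}(2)$, or $\beta<1$ and the system $X_u\oplus X_v=\mathbf{I}(A(u,v)>D(u,v))$ for all $\{u,v\}\in E_C$ has a solution over $\mathrm{GF}(2)$. Then the worm process $P$ on $G_C$ with edge weights $\beta_e$ (defined from that solution) has mixing time $$\tau_\varepsilon(P)\le 4m^5|E_C|^2\left(\frac{\ln(2\varepsilon^{-1})}{|E_C|}+\ln\frac{2}{x_{\min}}\right),$$ where $x_{\min}=\min_{e\in E_C}x_e$.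
   Context: Let $G=(V,E)$ be a finite connected simple 4-regular graph with, at each vertex, its four incident edges labelled bijectively $x_1,\dots,x_4$. Each edge has two half-edges. Pairing at each vertex slot $x_1$ with $x_4$ and $x_2$ with $x_3$, and following edges by entering a vertex through one slot of a pair and leaving through the other, partitions $E$ into closed trails (circuits) $C_1,\dots,C_m$, each with a fixed reference half-edge $h_i$. The four-vertex model assigns to a map $\sigma$ from half-edges to $\{0,1\}$ (opposite values on the two half-edges of each edge) the weight $\prod_v f^*_v(\sigma)$, where $f^*(0011)=f^*(1100)=\beta$, $f^*(0101)=f^*(1010)=1$, $f^*=0$ otherwise, evaluated at $v$ on its half-edges in slot order $x_1,\dots,x_4$. In nonzero-weight maps values alternate along circuits; $\sigma(C_i):=\sigma(h_i)$. A vertex where $\{x_1,x_4\}$ lies on $C_i$ and $\{x_2,x_3\}$ on $C_j$, $i\neq j$, is an agree-vertex if its weight is $\beta$ exactly when $\sigma(C_i)=\sigma(C_j)$ (else $1$), and a disagree-vertex if its weight is $\beta$ exactly when $\sigma(C_i)\neq\sigma(C_j)$; $A(i,j),D(i,j)$ count them. $G_C=(\mathcal{C},E_C)$, $\mathcal{C}=\{C_1,\dots,C_m\}$, has edge $\{C_i,C_j\}$ iff $i\ne j$ and they share such a vertex. Given a solution $(X_i)$ of the relevant system, for each $i$ with $X_i=1$ replace $h_i$ by an adjacent half-edge of $C_i$ (complementing $\sigma(C_i)$), recompute $A,D$, and set $\beta_e=\beta^{A(u,v)-D(u,v)}$ and $x_e=(\beta_e-1)/(\beta_e+1)$ for $e=\{u,v\}\in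 E_C$. Worm process. $\Omega_k$: sets $S\subseteq E_C$ with exactly $k$ odd-degree vertices in $(\mathcal{C},S)$, $\partial S$ that set; state space $\Omega_{worm}=\Omega_0\cup\Omega_2$; $d(u)$ is the degree of $u$ in $G_C$. For $\{u,v\}\in E_C$ and $A\in\Omega_{worm}$, with $A\oplus uv$ the symmetric difference of $A$ and $\{\{u,v\}\}$: $P(A,A\oplus uv)=x_{uv}^{\mathbf{I}(uv\notin A)}\frac1{2m}\big(\frac1{d(u)}+\frac1{d(v)}\big)$ if $A\in\Omega_0$; $=x_{uv}^{\mathbf{I}(uv\notin A)}\frac14\big(\frac1{d(u)}+\frac1{d(v)}\big)$ if $A\oplus uv\in\Omega_0$; $=\min\!\big(1,\frac{d(u)}{d(v)}x_{uv}^{\mathbf{I}(uv\notin A)-\mathbf{I}(uv\in A)}\big)\frac{1}{4d(u)}$ if $A,A\oplus uv\in\Omega_2$ and $u\in\partial A$; other off-diagonal entries $0$, diagonal entries $1$ minus the rest of the row. Its stationary distribution is $\pi(S)\propto\xi(S)\prod_{e\in S}x_e$ with $\xi=m$ on $\Omega_0$, $2$ on $\Omega_2$. Mixing time: $\tau_\varepsilon(P)=\min\{t:\max_{x\in\Omega_{worm}}\|P^t(x,\cdot)-\pi\|_{\mathrm{TV}}\le\varepsilon\}$, with $\|\mu-\nu\|_{\mathrm{TV}}=\frac12\sum_x|\mu(x)-\nu(x)|$.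
   Formalization: The formal theorem assumes E_C nonempty and x_min > 0 (otherwise the bound is undefined: x_e = 0 whenever A = D on an edge) and takes 0 < ε < 1 (for large ε the bound can be negative). *)

(* Defs.v *)
From HB Require Import structures.
From mathcomp Require Import all_boot all_order all_algebra.
From mathcomp Require Import reals exp.

Set Implicit Arguments.
Unset Strict Implicit.
Unset Printing Implicit Defensive.

Import Order.TTheory GRing.Theory Num.Theory.
Local Open Scope ring_scope.

(* A half-edge is a pair (v, i) : V * 'I_4, meaning "slot x_(i+1) at v".     *)
(* The edges are given by a fixed-point-free involution [mate] on half-edges *)
(* (the two half-edges of an edge).  Every vertex has exactly 4 slots, so   *)
(* the graph is 4-regular, and the slot labelling is the bijective labelling *)
(* x_1,...,x_4 of the four incident edges.                                  *)

Definition halfedge (V : finType) := (V * 'I_4)%type.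

Definition s0 : 'I_4 := @Ordinal 4 0 isT.
Definition s1 : 'I_4 := @Ordinal 4 1 isT.
Definition s2 : 'I_4 := @Ordinal 4 2 isT.
Definition s3 : 'I_4 := @Ordinal 4 3 isT.

Definition gadj (V : finType) (mate : halfedge V -> halfedge V) : rel V :=
  fun u w => [exists i : 'I_4, (mate (u, i)).1 == w].

Definition four_regular_simple_connected (V : finType)
    (mate : halfedge V -> halfedge V) : Prop :=
  [/\ (forall h, mate (mate h) = h),
      (forall h, (mate h).1 != h.1),
      (forall v (i j : 'I_4), i != j ->
          (mate (v, i)).1 != (mate (v, j)).1)
    & (forall u w, connect (gadj mate) u w)].

Definition pairslot (V : finType) (h : halfedge V) : halfedge V :=
  (h.1, rev_ord h.2).

(* one step along a circuit: cross the edge, or pass through the vertex *)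
Definition circ_rel (V : finType) (mate : halfedge V -> halfedge V)
  : rel (halfedge V) :=
  fun h h' => (h' == mate h) || (h' == pairslot h).

Definition on_circ (V : finType) (mate : halfedge V -> halfedge V)
    (r h : halfedge V) : bool :=
  connect (circ_rel mate) r h.

(* C_1,...,C_m (indexed by 'I_m) is an enumeration of all the circuits, *)
(* C_i being the circuit through its reference half-edge ref i.          *)
Definition circuit_enum (V : finType) (mate : halfedge V -> halfedge V)
    (m : nat) (ref : 'I_m -> halfedge V) : Prop :=
  (forall i j, on_circ mate (ref i) (ref j) -> i = j) /\
  (forall h, exists i, on_circ mate (ref i) h).

Section FourVertex.
Variable R : realType.
Variable beta : R.
Variable V : finType.
Variable mate : halfedge V -> halfedge V.

Definition fstar (a b c d : bool) : R :=
  if [&& a == b, c == d & a != c] then beta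
  else if [&& a != b, a == c & b == d] then 1
  else 0.

Definition fvert (sigma : {ffun halfedge V -> bool}) (v : V) : R :=
  fstar (sigma (v, s0)) (sigma (v, s1)) (sigma (v, s2)) (sigma (v, s3)).

Definition nonzero_config (sigma : {ffun halfedge V -> bool}) : bool :=
  [forall h, sigma (mate h) == ~~ sigma h] &&
  (\prod_(v : V) fvert sigma v != 0).

Variable m : nat.
Variable ref : 'I_m -> halfedge V.

Definition inC (i : 'I_m) (h : halfedge V) : bool := on_circ mate (ref i) h.

(* {x_1,x_4} lies on C_i and {x_2,x_3} on C_j, i <> j *)
Definition crossing (v : V) (i j : 'I_m) : bool :=
  [&& i != j, inC i (v, s0) & inC j (v, s1)].

Definition agreeV (v : V) (i j : 'I_m) : bool :=
  crossing v i j &&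
  [forall sigma : {ffun halfedge V -> bool}, nonzero_config sigma ==>
     (fvert sigma v == if sigma (ref i) == sigma (ref j) then beta else 1)].

Definition disagreeV (v : V) (i j : 'I_m) : bool :=
  crossing v i j &&
  [forall sigma : {ffun halfedge V -> bool}, nonzero_config sigma ==>
     (fvert sigma v == if sigma (ref i) != sigma (ref j) then beta else 1)].

Definition Acnt (i j : 'I_m) : nat :=
  #|[set v | agreeV v i j || agreeV v j i]|.
Definition Dcnt (i j : 'I_m) : nat :=
  #|[set v | disagreeV v i j || disagreeV v j i]|.

(* the same counts for an edge e = {u, v} of G_C given as a 2-subset *)
Definition AcntE (e : {set 'I_m}) : nat :=
  #|[set v | [exists i, exists j, [&& i \in e, j \in e & agreeV v i j]]]|.
Definition DcntE (e : {set 'I_m}) : nat :=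
  #|[set v | [exists i, exists j, [&& i \in e, j \in e & disagreeV v i j]]]|.

End FourVertex.

Definition adjC (V : finType) (mate : halfedge V -> halfedge V) (m : nat)
    (ref : 'I_m -> halfedge V) (i j : 'I_m) : bool :=
  (i != j) &&
  [exists v, crossing mate ref v i j || crossing mate ref v j i].

Definition EC (V : finType) (mate : halfedge V -> halfedge V) (m : nat)
    (ref : 'I_m -> halfedge V) : {set {set 'I_m}} :=
  [set [set i; j] | i in 'I_m, j in 'I_m & adjC mate ref i j].

(* The worm process on a graph with vertex set 'I_m, edge set E and edge    *)
(* weights x (edges are 2-subsets of 'I_m).                                 *)

Section Worm.
Variable R : realType.
Variable m : nat.
Variable E : {set {set 'I_m}}.
Variable x : {set 'I_m} -> R.

Definition deg (u : 'I_m) : nat := #|[set e in E | u \in e]|.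

Definition bd (S : {set {set 'I_m}}) : {set 'I_m} :=
  [set u | odd #|[set e in S | u \in e]|].

Definition Omega0 : {set {set {set 'I_m}}} :=
  [set S : {set {set 'I_m}} | (S \subset E) && (#|bd S| == 0%N)].
Definition Omega2 : {set {set {set 'I_m}}} :=
  [set S : {set {set 'I_m}} | (S \subset E) && (#|bd S| == 2%N)].
Definition Omega_worm : {set {set {set 'I_m}}} := Omega0 :|: Omega2.

Definition symd (A : {set {set 'I_m}}) (e : {set 'I_m}) : {set {set 'I_m}} :=
  if e \in A then A :\ e else e |: A.

Definition invdeg (u : 'I_m) : R := ((deg u)%:R)^-1.

Definition Pstep (A : {set {set 'I_m}}) (e : {set 'I_m}) : R :=
  let xfac := if e \in A then 1 else x e in
  if A \in Omega0 then
    xfac * (((2 * m)%:R)^-1 * \sum_(u in e) invdeg u)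
  else if symd A e \in Omega0 then
    xfac * (4^-1 * \sum_(u in e) invdeg u)
  else if (A \in Omega2) && (symd A e \in Omega2) then
    \sum_(u in e | u \in bd A) \sum_(v in e | v != u)
      Num.min 1 ((deg u)%:R / (deg v)%:R *
                 x e ^ ((e \notin A)%:Z - (e \in A)%:Z)) /
      (4 * (deg u)%:R)
  else 0.

(* transition matrix (only used on Omega_worm) *)
Definition Pworm (A B : {set {set 'I_m}}) : R :=
  if A == B then 1 - \sum_(e in E) Pstep A e
  else \sum_(e in E | B == symd A e) Pstep A e.

Fixpoint Ppow (t : nat) (A B : {set {set 'I_m}}) : R :=
  match t with
  | 0%N => if A == B then 1 else 0
  | t'.+1 => \sum_(C in Omega_worm) Ppow t' A C * Pworm C B
  end.

Definition wworm (S : {set {set 'I_m}}) : R :=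
  (if S \in Omega0 then m%:R else 2) * \prod_(e in S) x e.
Definition piworm (S : {set {set 'I_m}}) : R :=
  wworm S / \sum_(T in Omega_worm) wworm T.

Definition tv_dist (t : nat) (A : {set {set 'I_m}}) : R :=
  2^-1 * \sum_(B in Omega_worm) `|Ppow t A B - piworm B|.

Definition mixed (eps : R) (t : nat) : Prop :=
  forall A, A \in Omega_worm -> tv_dist t A <= eps.

(* tau_eps(P) <= b, where tau_eps(P) = min {t | mixed eps t}:            *)
(* the minimum is <= b iff some t with [mixed eps t] satisfies t <= b.   *)
Definition mixing_time_le (eps b : R) : Prop :=
  exists t : nat, mixed eps t /\ t%:R <= b.

End Worm.

Definition beta_e (R : realType) (beta : R) (V : finType)
    (mate : halfedge V -> halfedge V) (m : nat) (ref : 'I_m -> halfedge V)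
    (e : {set 'I_m}) : R :=
  beta ^ ((AcntE beta mate ref e)%:Z - (DcntE beta mate ref e)%:Z).

Definition x_e (R : realType) (beta : R) (V : finType)
    (mate : halfedge V -> halfedge V) (m : nat) (ref : 'I_m -> halfedge V)
    (e : {set 'I_m}) : R :=
  (beta_e beta mate ref e - 1) / (beta_e beta mate ref e + 1).

(* Main.v *)
(* The positivity of the edge weights gives 0 < x_e <= 1, and from there on only
   the worm process on an arbitrary finite graph matters.

   For a worm state D, insert the edges of D one at a time into the empty set so
   that at most two vertices are ever odd (remove an edge at an odd vertex,
   backwards).  For F with no odd vertex this gives a canonical path from F to
   F (+) D.  If it uses the transition M \ e -> M or back, then
   x^F x^(F (+) D) = x^M x^(M (+) D) and D is recovered from M (+) D, so that the
   congestion is controlled by sums of x^C over sets C with prescribed odd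
   vertices; by the high-temperature expansion these are at most Z0, the sum
   over sets without odd vertex.  Averaging over F instead of over both
   endpoints yields a Poincare inequality with constant 4 m^3 |E| for the
   Dirichlet form.  Since every holding probability is at least 1/2, the
   variance then contracts by 1 - 1/(4 m^3 |E|) at each step, and comparison with
   the minimum of pi leaves a factor m^2 to spare. *)
Require Import Defs.
From HB Require Import structures.
From mathcomp Require Import all_boot all_order all_algebra.
From mathcomp Require Import reals sequences exp.
From mathcomp Require Import ring lra zify.
Import Order.TTheory GRing.Theory Num.Theory.
Local Open Scope ring_scope.

Set Implicit Arguments.
Unset Strict Implicit.
Unset Printing Implicit Defensive.

(** * Subsets as a vector space over GF(2) *)

Section SymmetricDifference.
Variable T : finType.
Implicit Types A B C : {set T}.

Definition sdiff A B : {set T} := [set z | (z \in A) (+) (z \in B)].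

Lemma in_sdiff z A B : (z \in sdiff A B) = (z \in A) (+) (z \in B).
Proof. by rewrite inE. Qed.

Lemma sdiffC A B : sdiff A B = sdiff B A.
Proof. by apply/setP=> z; rewrite !inE addbC. Qed.

Lemma sdiffA A B C : sdiff A (sdiff B C) = sdiff (sdiff A B) C.
Proof. by apply/setP=> z; rewrite !inE addbA. Qed.

Lemma sdiff0 A : sdiff A set0 = A.
Proof. by apply/setP=> z; rewrite !inE addbF. Qed.

Lemma sdiffvv A : sdiff A A = set0.
Proof. by apply/setP=> z; rewrite !inE addbb. Qed.

Lemma sdiffK B : involutive (sdiff^~ B).
Proof. by move=> A /=; rewrite -sdiffA sdiffvv sdiff0. Qed.

Lemma sdiff_eq0 A B : (sdiff A B == set0) = (A == B).
Proof.
apply/eqP/eqP=> [h|->]; last exact: sdiffvv.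
by rewrite -[A](sdiffK B) h sdiffC sdiff0.
Qed.

Lemma sdiff_sub A B C : A \subset C -> B \subset C -> sdiff A B \subset C.
Proof.
move=> /subsetP hA /subsetP hB; apply/subsetP=> z; rewrite in_sdiff.
by case hz: (z \in A) => /= h; [apply: hA | apply: hB].
Qed.

Lemma sdiff_disjoint A B : [disjoint A & B] -> sdiff A B = A :|: B.
Proof.
rewrite disjoint_subset => /subsetP h; apply/setP=> z; rewrite !inE.
by move: (h z); rewrite inE; case: (z \in A) => // /(_ isT) /negbTE ->.
Qed.

Lemma sdiff1_notin A z : z \notin A -> sdiff A [set z] = z |: A.
Proof. by move=> h; rewrite sdiffC sdiff_disjoint // disjoints1. Qed.

(** Parity is a GF(2)-sum of indicators. This makes [bd] linear and [chi] multiplicative. *)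
Lemma odd_card_sdiff (P : pred T) A B :
  odd #|[set z in sdiff A B | P z]|
  = odd #|[set z in A | P z]| (+) odd #|[set z in B | P z]|.
Proof.
have parity C : odd #|[set z in C | P z]|
    = \big[addb/false]_(z : T) ((z \in C) && P z).
  rewrite cardsE -sum1_card (big_morph odd oddD (erefl _)) big_mkcond /=.
  by apply: eq_bigr => z _; rewrite unfold_in /=; case: (_ && _).
rewrite !parity -big_split /=; apply: eq_bigr => z _.
by rewrite in_sdiff; case: (z \in A); case: (z \in B); case: (P z).
Qed.

End SymmetricDifference.

(** * The boundary of an edge set as a linear map *)

Section Boundary.
Variable m : nat.
Implicit Types (S : {set {set 'I_m}}) (e : {set 'I_m}).

Lemma symd_sdiff S e : symd S e = sdiff S [set e].
Proof.
rewrite /symd; apply/setP=> z; rewrite inE; case: ifP => he; rewrite !inE.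
  by case: eqP => [->|_]; rewrite ?he //= addbF.
by case: eqP => [->|_]; rewrite ?he //= addbF.
Qed.

Lemma bd_sdiff S1 S2 : bd (sdiff S1 S2) = sdiff (bd S1) (bd S2).
Proof. by apply/setP=> u; rewrite !inE odd_card_sdiff. Qed.

Lemma bd_set1 e : bd [set e] = e.
Proof.
apply/setP=> u; rewrite inE; case he: (u \in e).
  rewrite (_ : [set _ in _ | _] = [set e]) ?cards1 //.
  by apply/setP=> f; rewrite !inE; case: eqP => // ->.
rewrite (_ : [set _ in _ | _] = set0) ?cards0 //.
by apply/setP=> f; rewrite !inE; case: eqP => // ->.
Qed.

Lemma bd_symd S e : bd (symd S e) = sdiff (bd S) e.
Proof. by rewrite symd_sdiff bd_sdiff bd_set1. Qed.

Lemma symdK e : involutive (fun S => symd S e).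
Proof. by move=> S; rewrite !symd_sdiff sdiffK. Qed.

Lemma bd0 : bd (set0 : {set {set 'I_m}}) = set0.
Proof. by rewrite -(sdiffvv (set0 : {set {set 'I_m}})) bd_sdiff sdiffvv. Qed.

(** The symmetric difference has 4 - 2k elements, where k is the size of the intersection, here 1 or
    2. *)
Lemma sdiff_edge_card (B e : {set 'I_m}) :
  #|B| = 2%N -> #|e| = 2%N -> B :&: e != set0 ->
  #|sdiff B e| = 0%N \/ #|sdiff B e| = 2%N.
Proof.
move=> hB he h.
have E1 : (#|sdiff B e| + 2 * #|B :&: e| = 4)%N.
  have -> : sdiff B e = (B :\: e) :|: (e :\: B).
    by apply/setP=> z; rewrite !inE; case: (z \in B); case: (z \in e).
  have h0 := cardsUI (B :\: e) (e :\: B).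
  have hI : (B :\: e) :&: (e :\: B) = set0.
    by apply/setP=> z; rewrite !inE; case: (z \in B); case: (z \in e).
  have := cardsID e B; have := cardsID B e; move: h0.
  by rewrite hI cards0 (setIC e B) hB he; lia.
by move: h; rewrite -card_gt0; lia.
Qed.

End Boundary.

(** * Characters and the high-temperature expansion *)

Section Fourier.
Variables (R : realType) (m : nat) (E : {set {set 'I_m}}).
Variable x : {set 'I_m} -> R.
Implicit Types (S : {set {set 'I_m}}) (e B tau : {set 'I_m}).

(** With [tau] read as the set of spins -1, this is the product of the spins over [B]; it is also a
    character of the group of vertex sets. *)
Definition chi tau B : R := (-1) ^+ odd #|[set z in B | z \in tau]|.

Lemma chi_sdiff tau A B : chi tau (sdiff A B) = chi tau A * chi tau B.
Proof. by rewrite /chi odd_card_sdiff signr_addb. Qed.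

Lemma chiC tau B : chi tau B = chi B tau.
Proof.
by rewrite /chi; congr (_ ^+ odd #|pred_of_set _|); apply/setP=> z; rewrite !inE andbC.
Qed.

Lemma chi0 tau : chi tau set0 = 1.
Proof.
rewrite /chi (_ : [set _ in _ | _] = set0) ?cards0 //.
by apply/setP=> z; rewrite !inE.
Qed.

Lemma chi_bd tau S : chi tau (bd S) = \prod_(e in S) chi tau e.
Proof.
move: {2}#|S| (leqnn #|S|) => n; elim: n S => [|n IH] S.
  by rewrite leqn0 cards_eq0 => /eqP ->; rewrite bd0 chi0 big_set0.
have [->|[e eS]] := set_0Vmem S; first by rewrite bd0 chi0 big_set0.
rewrite (cardsD1 e) eS add1n ltnS => /IH {}IH.
rewrite (big_setD1 e) //= -IH -chi_sdiff sdiffC -{1}(setD1K eS).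
by rewrite -sdiff1_notin ?inE ?eqxx // bd_sdiff bd_set1.
Qed.

(** Orthogonality of characters: toggling a vertex of [B] in [tau] flips the sign, so for nonempty
    [B] the sum is its own negative. *)
Lemma sum_chi B : \sum_tau chi tau B = if B == set0 then 2 ^+ m else 0.
Proof.
have [->|] := eqVneq B set0.
  under eq_bigr do rewrite chi0.
  by rewrite sumr_const -cardsT -powersetT card_powerset cardsT card_ord natrX.
move=> /set0Pn[u uB].
have: \sum_tau chi tau B = - \sum_tau chi tau B.
  rewrite {1}(reindex_inj (can_inj (sdiffK [set u]))) /= -sumrN.
  apply: eq_bigr => tau _; rewrite chiC chi_sdiff (chiC B tau).
  rewrite {2}/chi (_ : [set _ in _ | _] = [set u]) ?cards1 ?mulrN1 //.
  by apply/setP=> z; rewrite !inE; case: eqP => [->|].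
by move=> h; lra.
Qed.

Definition xprod S : R := \prod_(e in S) x e.

(** The numerator of the Ising correlation of the spins in [B], in high-temperature form. *)
Definition zpart B : R :=
  \sum_(S : {set {set 'I_m}} | (S \subset E) && (bd S == B)) xprod S.

Lemma prod_chi tau :
  \prod_(e in E) (1 + x e * chi tau e)
  = \sum_(S : {set {set 'I_m}} | S \subset E) xprod S * chi tau (bd S).
Proof.
(* Factors 1 outside [E] extend the product to the whole type, where distributivity gives a sum over
   all [S]; those not inside [E] vanish. *)
transitivity (\prod_(e : {set 'I_m})
    ((if e \in E then x e * chi tau e else 0) + 1)).
  rewrite big_mkcond /=; apply: eq_bigr => e _.
  by case: ifP => _; rewrite ?add0r // addrC.
rewrite bigA_distr [RHS]big_mkcond /=; apply: eq_bigr => S _.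
case: ifP => [/subsetP SE|/negbT /subsetPn[e eS eE]].
  rewrite chi_bd /xprod -big_split /= [RHS]big_mkcond /=.
  by apply: eq_bigr => e _; case: ifP => // /SE ->.
by rewrite (bigD1 e) //= eS (negbTE eE) mul0r.
Qed.

(** After exchanging the sums, orthogonality selects the [S] with boundary [B]. *)
Lemma zpart_fourier B :
  \sum_tau chi tau B * \prod_(e in E) (1 + x e * chi tau e) = 2 ^+ m * zpart B.
Proof.
under eq_bigr do rewrite prod_chi mulr_sumr.
rewrite exchange_big /= /zpart mulr_sumr [RHS]big_mkcondr /=.
apply: eq_bigr => S _.
transitivity (xprod S * \sum_tau chi tau (sdiff (bd S) B)).
  rewrite mulr_sumr; apply: eq_bigr => tau _.
  by rewrite chi_sdiff mulrCA (mulrC (chi tau B)).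
by rewrite sum_chi sdiff_eq0; case: ifP => _; rewrite ?mulr0 // mulrC.
Qed.

(* Griffiths-type bound: the ratio is an Ising correlation, at most [1]. *)
Lemma zpart_le0 B : (forall e, e \in E -> 0 <= x e <= 1) ->
  zpart B <= zpart set0.
Proof.
move=> x01; rewrite -(ler_pM2l (_ : 0 < 2 ^+ m)) ?exprn_gt0 //.
rewrite -!zpart_fourier; apply: ler_sum => tau _.
rewrite chi0; apply: ler_wpM2r.
  apply: prodr_ge0 => e /x01 /andP[h0 h1]; rewrite /chi.
  by case: (odd _); rewrite ?expr1 ?expr0; lra.
by rewrite /chi; case: (odd _); rewrite ?expr1 ?expr0; lra.
Qed.

End Fourier.

(** * Worm states and canonical insertion orders *)

Section StateSpace.
Variables (m : nat) (E : {set {set 'I_m}}).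
Hypothesis E2 : forall e, e \in E -> #|e| = 2%N.
Implicit Types (S D : {set {set 'I_m}}) (e : {set 'I_m}).

Lemma in_Omega0 S : (S \in Omega0 E) = (S \subset E) && (bd S == set0).
Proof. by rewrite inE cards_eq0. Qed.

Lemma in_Omega2 S : (S \in Omega2 E) = (S \subset E) && (#|bd S| == 2%N).
Proof. by rewrite inE. Qed.

Lemma in_Omega_worm S :
  (S \in Omega_worm E) = (S \subset E) && ((bd S == set0) || (#|bd S| == 2%N)).
Proof. by rewrite inE in_Omega0 in_Omega2 -andb_orr. Qed.

Lemma Omega_worm_sub S : S \in Omega_worm E -> S \subset E.
Proof. by rewrite in_Omega_worm => /andP[]. Qed.

Lemma symd_sub S e : e \in E -> S \subset E -> symd S e \subset E.
Proof. by move=> eE SE; rewrite symd_sdiff sdiff_sub // sub1set. Qed.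

(** Adding an even set preserves boundaries. Hence a path from the empty set to [D] translates to
    one starting at any even [F]. *)
Lemma sdiff_Omega0_worm F D : F \in Omega0 E ->
  (sdiff F D \in Omega_worm E) = (D \in Omega_worm E).
Proof.
rewrite in_Omega0 => /andP[FE /eqP F0]; rewrite !in_Omega_worm bd_sdiff F0.
rewrite (sdiffC set0) sdiff0; congr (_ && _); apply/idP/idP => [h|]; last exact: sdiff_sub.
by rewrite -[D](sdiffK F) sdiffC sdiff_sub // sdiffC.
Qed.

Lemma sdiff_Omega0 F D : F \in Omega0 E -> D \subset E ->
  (sdiff F D \in Omega0 E) = (D \in Omega0 E).
Proof.
rewrite !in_Omega0 => /andP[FE /eqP F0] DE; rewrite bd_sdiff F0.
by rewrite (sdiffC set0) sdiff0 sdiff_sub // DE.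
Qed.

Lemma symd_Omega0 S e : S \in Omega0 E -> e \in E -> symd S e \in Omega2 E.
Proof.
rewrite in_Omega0 in_Omega2 => /andP[SE /eqP S0] eE; rewrite symd_sub //=.
by rewrite bd_symd S0 sdiffC sdiff0 E2.
Qed.

Lemma Omega0_not2 S : S \in Omega0 E -> S \notin Omega2 E.
Proof. by rewrite in_Omega0 in_Omega2 => /andP[_ /eqP ->]; rewrite cards0 andbF. Qed.

(** An even state may lose any edge. Otherwise some edge meets an odd vertex, and removing it either
    moves that odd vertex or cancels both. *)
Lemma removable_edge D : D \in Omega_worm E -> D != set0 ->
  exists2 e, e \in D & D :\ e \in Omega_worm E.
Proof.
move=> DO /set0Pn[e0 e0D].
have [De _] := andP (etrans (esym (in_Omega_worm D)) DO).
have rem e : e \in D -> D :\ e = symd D e by rewrite /symd => ->.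
move: (DO); rewrite in_setU => /orP[D0|].
  exists e0 => //; rewrite rem // in_setU.
  by rewrite symd_Omega0 ?orbT // (subsetP De).
rewrite in_Omega2 => /andP[_ /eqP D2].
have /set0Pn[u uD] : bd D != set0 by rewrite -card_gt0 D2.
have /set0Pn[e] : [set e in D | u \in e] != set0.
  by rewrite -card_gt0; move: uD; rewrite inE; case: #|_|.
rewrite inE => /andP[eD ue]; exists e => //.
have eE := subsetP De _ eD.
rewrite rem // in_Omega_worm symd_sub // bd_symd -cards_eq0.
case: (sdiff_edge_card D2 (E2 eE)) => [|->|->] //.
by apply/set0Pn; exists u; rewrite inE uD.
Qed.

(* An order in which the edges of [D] can be inserted one by one from the empty
   set while staying inside the state space; [Pre e] collects the edges
   inserted before [e], and the last clause says that increments telescope. *)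
Lemma canonical_order (R : realType) D : D \in Omega_worm E ->
  exists Pre : {set 'I_m} -> {set {set 'I_m}},
    (forall e, e \in D ->
       [/\ Pre e \in Omega_worm E, symd (Pre e) e \in Omega_worm E,
           Pre e \subset D & e \notin Pre e])
    /\ forall h : {set {set 'I_m}} -> R,
         \sum_(e in D) (h (symd (Pre e) e) - h (Pre e)) = h D - h set0.
Proof.
move: {2}#|D| (leqnn #|D|) => n; elim: n D => [|n IH] D.
  rewrite leqn0 cards_eq0 => /eqP -> _; exists (fun=> set0); split.
    by move=> e; rewrite inE.
  by move=> h; rewrite big_set0 subrr.
have [->|D0] := eqVneq D set0.
  move=> _ _; exists (fun=> set0); split; first by move=> e; rewrite inE.
  by move=> h; rewrite big_set0 subrr.
move=> cD DO; have [e0 e0D D'O] := removable_edge DO D0.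
move: cD; rewrite (cardsD1 e0) e0D add1n ltnS => /IH /(_ D'O)[Pre [P1 P2]].
have e0E : symd (D :\ e0) e0 = D.
  by rewrite /symd !inE eqxx /= setD1K.
(* The removed edge [e0] is inserted last, after all the others. *)
exists (fun e => if e == e0 then D :\ e0 else Pre e); split.
  move=> e eD; case: eqP => [->|/eqP ne].
    by rewrite D'O e0E DO subsetDl !inE eqxx.
  have [|p1 p2 p3 p4] := P1 e; first by rewrite !inE ne.
  by rewrite p1 p2 p4 (subset_trans p3) // subsetDl.
move=> h; rewrite (big_setD1 e0) //= eqxx e0E.
rewrite (eq_bigr (fun e => h (symd (Pre e) e) - h (Pre e))); last first.
  by move=> e; rewrite !inE => /andP[/negbTE -> _].
by rewrite P2; ring.
Qed.

Lemma deg_le u : (deg E u <= m)%N.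
Proof.
rewrite -[leqRHS]card_ord.
apply: leq_trans (leq_imset_card (fun v : 'I_m => [set u; v]) predT).
apply/subset_leq_card/subsetP => e.
rewrite inE => /andP[/E2 /eqP/cards2P[a [b [ab ->]]]].
rewrite !inE => /orP[]/eqP ->; apply/imsetP; [by exists b | exists a => //].
by rewrite setUC.
Qed.

Lemma deg_gt0 u e : e \in E -> u \in e -> (0 < deg E u)%N.
Proof. by move=> eE ue; apply/card_gt0P; exists e; rewrite inE eE. Qed.

End StateSpace.

(** * Stationary flow through each kind of transition *)

Section Transitions.
Variables (R : realType) (m : nat) (E : {set {set 'I_m}}).
Variable x : {set 'I_m} -> R.
Hypothesis E2 : forall e, e \in E -> #|e| = 2%N.
Hypothesis x01 : forall e, e \in E -> 0 < x e <= 1.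
Implicit Types (A S : {set {set 'I_m}}) (e : {set 'I_m}).

Local Notation worm := (Omega_worm E).
Local Notation d u := ((deg E u)%:R : R).

Lemma xprod_gt0 S : S \subset E -> 0 < xprod x S.
Proof. by move=> /subsetP SE; rewrite /xprod prodr_gt0 // => e /SE /x01 /andP[]. Qed.

Lemma xprod_setU1 e A : e \notin A -> xprod x (e |: A) = x e * xprod x A.
Proof. by move=> eA; rewrite /xprod big_setU1. Qed.

(** The acceptance factor turns the weight of [A] into that of [e |: A], which is the same seen from
    either end of the transition. *)
Lemma xprod_setU1_if e A :
  xprod x A * (if e \in A then 1 else x e) = xprod x (e |: A).
Proof.
case: ifP => [eA|/negbT eA]; last by rewrite xprod_setU1 // mulrC.
by rewrite mulr1 (setUidPr _) // sub1set.
Qed.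

Lemma setU1_symd e A : e |: symd A e = e |: A.
Proof.
apply/setP=> f; rewrite symd_sdiff !inE.
by case: eqP => //= _; rewrite addbF.
Qed.

Lemma xprod_setU1_le e A : e \in E -> A \subset E ->
  xprod x (e |: A) <= xprod x A.
Proof.
move=> eE AE; rewrite -xprod_setU1_if ler_piMr //.
  exact/ltW/xprod_gt0.
by case: ifP => // _; case/andP: (x01 eE).
Qed.

Lemma invdeg_ge0 u : 0 <= invdeg R E u.
Proof. by rewrite invr_ge0 ler0n. Qed.

(** The factor m of the stationary weight cancels against 1/(2m); in the reverse direction 2 times
    1/4 gives the same 1/2. *)
Lemma Pstep_Omega0 A e : A \in Omega0 E -> e \in E ->
  wworm E x A * Pstep E x A e
  = 2^-1 * xprod x (e |: A) * \sum_(u in e) invdeg R E u.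
Proof.
move=> A0 eE; rewrite /wworm /Pstep A0 natrM invfM -xprod_setU1_if -/(xprod x A).
have m0 : m%:R != 0 :> R.
  have /card_gt0P[u _] : (0 < #|e|)%N by rewrite E2.
  by rewrite pnatr_eq0 -lt0n (leq_ltn_trans _ (ltn_ord u)).
by move: (if _ then _ else _) (\sum_(u in e) _) => y s; field.
Qed.

Lemma Pstep_to_Omega0 A e : A \in Omega2 E -> symd A e \in Omega0 E ->
  wworm E x A * Pstep E x A e
  = 2^-1 * xprod x (e |: A) * \sum_(u in e) invdeg R E u.
Proof.
move=> A2 A'0; have A0 : A \in Omega0 E = false.
  by apply: contraTF A2; exact: Omega0_not2.
rewrite /wworm /Pstep A0 A'0 -xprod_setU1_if -/(xprod x A).
by move: (if _ then _ else _) (\sum_(u in e) _) => y s; field.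
Qed.

(** With both ends of [e] odd the new boundary would be empty; with neither it would have four
    vertices. *)
Lemma Omega2_endpoints A e : A \in Omega2 E -> symd A e \in Omega2 E -> e \in E ->
  exists u v, [/\ e = [set u; v], u != v, u \in bd A & v \notin bd A].
Proof.
rewrite !in_Omega2 bd_symd => /andP[_ /eqP hA] /andP[_ /eqP hA'] eE.
have /eqP/cards2P[a [b [ab eab]]] := E2 eE.
case: (boolP (a \in bd A)) => ha; case: (boolP (b \in bd A)) => hb.
- move: hA'; rewrite (_ : bd A = e) ?sdiffvv ?cards0 //.
  apply/esym/eqP; rewrite eqEcard hA E2 // leqnn andbT eab.
  by apply/subsetP => z; rewrite in_set2 => /orP[]/eqP ->.
- by exists a, b.
- by exists b, a; rewrite setUC eq_sym.
have AI : bd A :&: e = set0.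
  apply/setP=> z; rewrite eab in_setI in_set2 in_set0.
  by apply/negP => /andP[zA /orP[]/eqP zE]; rewrite zE in zA; rewrite zA in ha hb.
move: hA'; rewrite sdiff_disjoint -?setI_eq0 ?AI //.
by rewrite cardsU AI hA E2 // cards0.
Qed.

(** The Metropolis rule: multiplied by the stationary weight, the minimum becomes symmetric under
    exchanging the two states together with [u] and [v]. *)
Lemma Pstep_Omega2 A e u v : A \in Omega2 E -> symd A e \in Omega2 E ->
  e \in E -> e = [set u; v] -> u != v -> u \in bd A -> v \notin bd A ->
  wworm E x A * Pstep E x A e
  = 2^-1 * Num.min (xprod x A / d u) (xprod x (symd A e) / d v).
Proof.
move=> A2 A'2 eE euv uv ua vb; have nO S : S \in Omega2 E -> S \in Omega0 E = false.
  by move=> S2; apply: contraTF S2; exact: Omega0_not2.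
have ue : u \in e by rewrite euv !inE eqxx.
have ve : v \in e by rewrite euv !inE eqxx orbT.
have du : 0 < d u by rewrite ltr0n (deg_gt0 eE).
have dv : 0 < d v by rewrite ltr0n (deg_gt0 eE).
have [x0 x1] := andP (x01 eE).
rewrite /wworm /Pstep !nO // A2 A'2 /= (bigD1 u) ?ue //=.
rewrite [X in _ * (_ + X)]big1 ?addr0; last first.
  move=> z /andP[/andP[ze zA] zu]; move: ze.
  by rewrite euv in_set2 (negbTE zu) => /eqP zv; rewrite zv (negbTE vb) in zA.
rewrite (bigD1 v) /=; last by rewrite ve eq_sym.
rewrite [X in _ * (_ + X)]big1 ?addr0; last first.
  move=> z /andP[/andP[ze zu] zv]; move: ze.
  by rewrite euv in_set2 (negbTE zu) (negbTE zv).
rewrite -/(xprod x A).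
have A0 : 0 < xprod x A by apply: xprod_gt0; case/andP: (etrans (esym (in_Omega2 E A)) A2).
(* The signed exponent encodes the ratio of the two weights. *)
have -> : xprod x (symd A e)
          = xprod x A * x e ^ ((e \notin A)%:Z - (e \in A)%:Z).
  rewrite /symd; case: (boolP (e \in A)) => eA /=.
    rewrite (_ : 0%:Z - 1%:Z = -1) // exprN1 /xprod [in RHS](big_setD1 e) //=.
    by rewrite mulrC mulKf ?gt_eqF.
  by rewrite xprod_setU1 // (_ : 1%:Z - 0%:Z = 1) // expr1z mulrC.
set q := x e ^ _.
have -> : xprod x A / d u = (xprod x A / d u) * 1 by rewrite mulr1.
have -> : xprod x A * q / d v = (xprod x A / d u) * (d u / d v * q).
  by field; rewrite !gt_eqF.
rewrite -minr_pMr ?divr_ge0 ?ltW //.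
by field; rewrite gt_eqF.
Qed.

End Transitions.

(** * Reversibility and bounds on transition probabilities *)

Section TransitionBounds.
Variables (R : realType) (m : nat) (E : {set {set 'I_m}}).
Variable x : {set 'I_m} -> R.
Hypothesis E2 : forall e, e \in E -> #|e| = 2%N.
Hypothesis x01 : forall e, e \in E -> 0 < x e <= 1.
Implicit Types (A S : {set {set 'I_m}}) (e : {set 'I_m}).

Local Notation worm := (Omega_worm E).
Local Notation d u := ((deg E u)%:R : R).

(** Three kinds of moves remain, since flipping one edge never leads from an even state to an even
    state. *)
Lemma worm_cases (Q : {set {set 'I_m}} -> {set 'I_m} -> Prop) :
  (forall A e, e \in E -> A \in Omega0 E -> symd A e \in Omega2 E -> Q A e) ->
  (forall A e, e \in E -> A \in Omega2 E -> symd A e \in Omega0 E -> Q A e) ->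
  (forall A e u v, e \in E -> A \in Omega2 E -> symd A e \in Omega2 E ->
     e = [set u; v] -> u != v -> u \in bd A -> v \notin bd A -> Q A e) ->
  forall A e, e \in E -> A \in worm -> symd A e \in worm -> Q A e.
Proof.
move=> h02 h20 h22 A e eE; rewrite in_setU => /orP[A0|A2] A'.
  by apply: h02 => //; exact: symd_Omega0.
move: A'; rewrite in_setU => /orP[A'0|A'2]; first exact: h20.
by have [u [v []]] := Omega2_endpoints E2 A2 A'2 eE; exact: h22.
Qed.

Lemma Pstep_reversible A e : e \in E -> A \in worm -> symd A e \in worm ->
  wworm E x A * Pstep E x A e = wworm E x (symd A e) * Pstep E x (symd A e) e.
Proof.
move: A e; apply: worm_cases => [A e eE A0 A'2|A e eE A2 A'0|A e u v eE A2 A'2 euv uv ua vb].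
- by rewrite Pstep_Omega0 // Pstep_to_Omega0 ?symdK // setU1_symd.
- by rewrite Pstep_to_Omega0 // Pstep_Omega0 // setU1_symd.
have vu : v != u by rewrite eq_sym.
have evu : e = [set v; u] by rewrite setUC.
have ua' : u \notin bd (symd A e).
  by rewrite bd_symd in_sdiff ua euv !in_set2 eqxx.
have vb' : v \in bd (symd A e).
  by rewrite bd_symd in_sdiff (negbTE vb) euv !in_set2 eqxx orbT.
have A''2 : symd (symd A e) e \in Omega2 E by rewrite symdK.
rewrite (Pstep_Omega2 x01 A2 A'2 eE euv uv ua vb).
by rewrite (Pstep_Omega2 x01 A'2 A''2 eE evu vu vb' ua') symdK minC.
Qed.

Lemma invdeg_ge u e : e \in E -> u \in e -> m%:R^-1 <= invdeg R E u.
Proof.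
move=> eE ue; have du := deg_gt0 eE ue.
by rewrite lef_pV2 ?posrE ?ltr0n ?ler_nat ?deg_le // (leq_trans du) ?deg_le.
Qed.

(** Degrees are at most m and, as [x e <= 1], both ends of the transition weigh at least as much as
    [e |: A]. *)
Lemma Pstep_lower A e : e \in E -> A \in worm -> symd A e \in worm ->
  xprod x (e |: A) / (2 * m%:R) <= wworm E x A * Pstep E x A e.
Proof.
move=> eE Aw A'w; have AE := Omega_worm_sub Aw.
have M0 : 0 < xprod x (e |: A) by rewrite (xprod_gt0 x01) // subUset sub1set eE.
(* Counting a single endpoint gives the same bound as for moves inside [Omega2]. *)
have sum_ge : m%:R^-1 <= \sum_(u in e) invdeg R E u.
  have /card_gt0P[u ue] : (0 < #|e|)%N by rewrite E2.
  rewrite (bigD1 u) //= (le_trans (invdeg_ge eE ue)) // lerDl.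
  by apply: sumr_ge0 => v _; exact: invdeg_ge0.
have -> : xprod x (e |: A) / (2 * m%:R) = 2^-1 * xprod x (e |: A) * m%:R^-1.
  by rewrite invfM mulrCA mulrA.
have cmp : 2^-1 * xprod x (e |: A) * m%:R^-1
    <= 2^-1 * xprod x (e |: A) * \sum_(u in e) invdeg R E u.
  by rewrite ler_pM2l // mulr_gt0 ?invr_gt0 ?ltr0n.
move: A e eE Aw A'w AE M0 {sum_ge} cmp; apply: worm_cases
  => [A e eE A0 A'2|A e eE A2 A'0|A e u v eE A2 A'2 euv uv ua vb] AE M0 cmp.
- by rewrite Pstep_Omega0.
- by rewrite Pstep_to_Omega0.
rewrite (Pstep_Omega2 x01 A2 A'2 eE euv uv ua vb) -mulrA.
have ue : u \in e by rewrite euv in_set2 eqxx.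
have ve : v \in e by rewrite euv in_set2 eqxx orbT.
have m0 : 0 <= m%:R^-1 :> R by rewrite invr_ge0 ler0n.
have M0' := ltW M0.
rewrite ler_wpM2l ?invr_ge0 // le_min; apply/andP; split; apply: ler_pM => //.
- exact: (xprod_setU1_le x01).
- exact: (invdeg_ge eE ue).
- by rewrite -setU1_symd (xprod_setU1_le x01) // symd_sub.
- exact: (invdeg_ge eE ve).
Qed.

Lemma Pstep_ge0 A e : e \in E -> 0 <= Pstep E x A e.
Proof.
move=> eE; have [x0 _] := andP (x01 eE); rewrite /Pstep.
have s0 : 0 <= \sum_(u in e) invdeg R E u.
  by apply: sumr_ge0 => u _; exact: invdeg_ge0.
have y0 : 0 <= (if e \in A then 1 else x e) by case: ifP => _ //; exact: ltW.
do 2!(case: ifP => _; first by rewrite !mulr_ge0 // invr_ge0 ler0n).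
case: ifP => // _; apply: sumr_ge0 => u _; apply: sumr_ge0 => v _.
by rewrite divr_ge0 ?mulr_ge0 ?ler0n // le_min ler01 !mulr_ge0 ?invr_ge0 ?ler0n //
  exprz_ge0 ?ltW.
Qed.

Lemma Pstep_out A e : e \in E -> A \in worm -> symd A e \notin worm ->
  Pstep E x A e = 0.
Proof.
move=> eE; rewrite !in_setU negb_or => Aw /andP[A'0 A'2].
have A0 : A \in Omega0 E = false.
  by apply: contraNF A'2 => A0; exact: symd_Omega0.
by rewrite /Pstep A0 (negbTE A'0) (negbTE A'2) andbF.
Qed.

(** Double counting: a vertex of [U] lies on [deg E u] edges and receives the inverse degree from
    each, in total 1, or 0 if isolated. *)
Lemma sum_invdeg (U : {set 'I_m}) :
  \sum_(e in E) \sum_(u in e | u \in U) invdeg R E u <= #|U|%:R.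
Proof.
rewrite (exchange_big_dep (fun u => u \in U)) /=; last by move=> e u _ /andP[].
rewrite -sum1_card natr_sum; apply: ler_sum => u uU.
rewrite (eq_bigl (fun e => e \in [set e in E | u \in e])); last first.
  by move=> e; rewrite inE uU andbT.
rewrite sumr_const -/(deg E u) -[leLHS]mulr_natr /invdeg.
by case: (deg E u) => [|n]; rewrite ?mulr0 ?ler01 // mulVf // pnatr_eq0.
Qed.

(** Laziness: [sum_invdeg] is applied to all m vertices with factor 1/(2m), or to the two odd
    vertices with factor 1/4. *)
Lemma Pstep_row_sum A : A \in worm -> \sum_(e in E) Pstep E x A e <= 2^-1.
Proof.
move=> Aw; have [E0|[e0 e0E]] := set_0Vmem E.
  by rewrite big1 ?invr_ge0 // => e; rewrite E0 inE.
have m0 : 0 < m%:R :> R.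
  have /card_gt0P[u _] : (0 < #|e0|)%N by rewrite E2.
  by rewrite ltr0n (leq_ltn_trans _ (ltn_ord u)).
case A0: (A \in Omega0 E).
  apply: (@le_trans _ _ (\sum_(e in E) (2 * m)%:R^-1 *
                         \sum_(u in e | u \in [set: 'I_m]) invdeg R E u)).
    apply: ler_sum => e eE; rewrite /Pstep A0.
    under [X in _ <= _ * X]eq_bigl do rewrite in_setT andbT.
    have s0 : 0 <= \sum_(u in e) invdeg R E u.
      by apply: sumr_ge0 => u _; exact: invdeg_ge0.
    rewrite ler_piMl ?mulr_ge0 ?invr_ge0 ?ler0n //.
    by case: ifP => // _; case/andP: (x01 eE).
  rewrite -mulr_sumr; apply: le_trans (ler_wpM2l _ (sum_invdeg _)) _.
    by rewrite invr_ge0 ler0n.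
  by rewrite cardsT card_ord natrM invfM divfK // gt_eqF.
have A2 : A \in Omega2 E by move: Aw; rewrite in_setU A0.
apply: (@le_trans _ _ (\sum_(e in E) 4^-1 *
                       \sum_(u in e | u \in bd A) invdeg R E u)); last first.
  rewrite -mulr_sumr; apply: le_trans (ler_wpM2l _ (sum_invdeg _)) _.
    by rewrite invr_ge0.
  by move: A2; rewrite in_Omega2 => /andP[_ /eqP ->]; lra.
apply: ler_sum => e eE; rewrite /Pstep A0 A2 /=.
have s0 : 0 <= \sum_(u in e | u \in bd A) invdeg R E u.
  by apply: sumr_ge0 => u _; exact: invdeg_ge0.
case: ifP => [A'0|_].
  (* A move into [Omega0] forces [e] to be the boundary of [A], so both of its ends are odd. *)
  have /eqP : sdiff (bd A) e == set0.
    by move: A'0; rewrite in_Omega0 bd_symd => /andP[].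
  move/eqP; rewrite sdiff_eq0 => /eqP bdA.
  have eqs : \sum_(u in e | u \in bd A) invdeg R E u = \sum_(u in e) invdeg R E u.
    by apply: eq_bigl => u; rewrite bdA andbb.
  rewrite -eqs ler_piMl ?mulr_ge0 ?invr_ge0 //.
  by case: ifP => // _; case/andP: (x01 eE).
case: ifP => [_|]; last by rewrite mulr_ge0 ?invr_ge0.
rewrite mulr_sumr; apply: ler_sum => u /andP[ue _].
have : (#|[set v in e | v != u]| = 1)%N.
  have -> : [set v in e | v != u] = e :\ u by apply/setP=> v; rewrite !inE andbC.
  by have := cardsD1 u e; rewrite ue (E2 eE); case: #|_| => [|[|n]].
rewrite -invfM => c1.
have cst : \sum_(v in e | v != u) (4 * d u)^-1 = (4 * d u)^-1.
  rewrite (eq_bigl (fun v => v \in [set v in e | v != u])).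
    by rewrite sumr_const c1 mulr1n.
  by move=> v; rewrite inE.
rewrite -[leRHS]cst; apply: ler_sum => v _.
rewrite ler_piMl ?invr_ge0 ?mulr_ge0 ?ler0n //.
by rewrite ge_min lexx.
Qed.

End TransitionBounds.

(** Weighted Cauchy-Schwarz by Lagrange's identity: twice the gap is a double sum of weighted
    squares. *)
Lemma sqr_weighted_sum_le (R : realDomainType) (I : finType) (P : pred I)
    (p z : I -> R) : (forall i, P i -> 0 <= p i) ->
  (\sum_(i | P i) p i * z i) ^+ 2
  <= (\sum_(i | P i) p i) * \sum_(i | P i) p i * z i ^+ 2.
Proof.
move=> p0; rewrite -subr_ge0 -(pmulr_lge0 _ (ltr0n R 2)).
suff -> : ((\sum_(i | P i) p i) * (\sum_(i | P i) p i * z i ^+ 2)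
           - (\sum_(i | P i) p i * z i) ^+ 2) * 2
    = \sum_(i | P i) \sum_(j | P j) p i * p j * (z i - z j) ^+ 2.
  apply: sumr_ge0 => i Pi; apply: sumr_ge0 => j Pj.
  by rewrite mulr_ge0 ?sqr_ge0 // mulr_ge0 ?p0.
set a := \sum_(i | P i) p i; set b := \sum_(i | P i) p i * z i ^+ 2.
set c := \sum_(i | P i) p i * z i.
have -> : (a * b - c ^+ 2) * 2 = (a * b + b * a) - (c * c + c * c) by ring.
rewrite !big_distrlr -!big_split -sumrB; apply: eq_bigr => i _ /=.
by rewrite -!big_split -sumrB; apply: eq_bigr => j _ /=; ring.
Qed.

(** * Canonical paths and the Poincare inequality *)

Section Poincare.
Variables (R : realType) (m : nat) (E : {set {set 'I_m}}).
Variable x : {set 'I_m} -> R.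
Hypothesis E2 : forall e, e \in E -> #|e| = 2%N.
Hypothesis x01 : forall e, e \in E -> 0 < x e <= 1.
Implicit Types (A S D F M : {set {set 'I_m}}) (e : {set 'I_m}).

Local Notation worm := (Omega_worm E).
Local Notation Z0 := (zpart E x set0).

(** Each edge of [D] occurs exactly once on either side; off [D], the sets [F] and [M] agree. *)
Lemma xprod_exchange F M D : (forall e, e \notin D -> (e \in F) = (e \in M)) ->
  xprod x F * xprod x (sdiff F D) = xprod x M * xprod x (sdiff M D).
Proof.
move=> FM; rewrite /xprod !(big_mkcond (fun e => e \in _)) -!big_split /=.
apply: eq_bigr => e _; rewrite !in_sdiff.
case: (boolP (e \in D)) => [_|/FM ->] //.
by case: (e \in F); case: (e \in M); rewrite /= ?mulr1 ?mul1r.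
Qed.

Lemma zpart0_Omega0 : Z0 = \sum_(F in Omega0 E) xprod x F.
Proof. by apply: eq_bigl => F; rewrite in_Omega0. Qed.

Lemma zpart0_gt0 : 0 < Z0.
Proof.
rewrite /zpart (bigD1 set0) ?sub0set ?bd0 ?eqxx //= ltr_wpDr //.
  by apply: sumr_ge0 => S /andP[/andP[SE _] _]; exact/ltW/(xprod_gt0 x01).
by rewrite (xprod_gt0 x01) ?sub0set.
Qed.

(* Each of the [1 + 'C(m, 2)] possible boundaries contributes at most [Z0]. *)
Lemma flow_bound M : M \subset E ->
  \sum_(D in worm) (if D \in Omega0 E then m%:R else 2) * xprod x (sdiff M D)
  <= m%:R ^+ 2 * Z0.
Proof.
move=> ME; pose xi (B : {set 'I_m}) : R := if B == set0 then m%:R else 2.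
rewrite (partition_big (@bd m) (fun B => (B == set0) || (#|B| == 2%N))) /=; last first.
  by move=> D; rewrite in_Omega_worm => /andP[].
apply: (@le_trans _ _ (\sum_(B : {set 'I_m} | (B == set0) || (#|B| == 2%N)) xi B * Z0)).
  apply: ler_sum => B Bok.
  apply: (@le_trans _ _ (xi B * zpart E x (sdiff (bd M) B))); last first.
    rewrite ler_wpM2l //; first by rewrite /xi; case: ifP.
    by apply: zpart_le0 => e /x01 /andP[/ltW -> ->].
  rewrite /zpart [X in _ <= _ * X](reindex_inj (can_inj (sdiffK M))) /= mulr_sumr.
  rewrite le_eqVlt; apply/orP; left; apply/eqP; apply: eq_big => [D|D].
    rewrite in_Omega_worm bd_sdiff; rewrite (sdiffC D) (sdiffC (bd D)).
    have -> : (sdiff (bd M) (bd D) == sdiff (bd M) B) = (bd D == B).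
      apply/eqP/eqP => [h|-> //]; apply: (can_inj (sdiffK (bd M))).
      by rewrite sdiffC h sdiffC.
    have -> : (sdiff M D \subset E) = (D \subset E).
      apply/idP/idP => h; last exact: sdiff_sub.
      by rewrite -[D](sdiffK M) (sdiffC D) sdiff_sub.
    by case: (bd D =P B) => [->|]; rewrite ?Bok ?andbT ?andbF.
  move=> /andP[Dw /eqP DB]; rewrite (sdiffC D) -DB /xi in_Omega0.
  by rewrite (Omega_worm_sub Dw).
rewrite -mulr_suml ler_wpM2r ?(ltW zpart0_gt0) //.
rewrite (bigD1 set0) ?eqxx //= {1}/xi eqxx.
rewrite (eq_big (fun B : {set 'I_m} => B \in [set B : {set 'I_m} | #|B| == 2%N])
               (fun=> 2)); first last.
- by move=> B /andP[_ /negbTE B0]; rewrite /xi B0.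
- by move=> B; rewrite inE; case: (B =P set0) => [->|_]; rewrite ?cards0 /= ?andbT.
rewrite sumr_const card_draws card_ord -[X in _ + X]mulr_natr -natrM -natrX -natrD ler_nat.
have -> : (2 * 'C(m, 2) = m * m.-1)%N by rewrite mulnC (bin_ffact m 2) ffactnS ffactn1.
by rewrite -mulnn; case: (m) => // n; rewrite /= -mulnS.
Qed.

Definition dirichlet (f : {set {set 'I_m}} -> R) : R :=
  \sum_(A in worm) \sum_(e in E)
     wworm E x A * Pstep E x A e * (f (symd A e) - f A) ^+ 2.

(** The constant is the product of the path length, at most [#|E|], the factor m^2 of [flow_bound]
    and the 2m of [Pstep_lower]. *)
Lemma canonical_paths (f : {set {set 'I_m}} -> R) :
  \sum_(D in worm) \sum_(F in Omega0 E)
     (if D \in Omega0 E then m%:R else 2) * xprod x (sdiff F D) * xprod x F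
       * (f (sdiff F D) - f F) ^+ 2
  <= 2 * m%:R ^+ 3 * #|E|%:R * Z0 * dirichlet f.
Proof.
pose xi D : R := if D \in Omega0 E then m%:R else 2.
have xi0 D : 0 <= xi D by rewrite /xi; case: ifP.
pose g A e := (f (symd A e) - f A) ^+ 2.
have [Pre PreP] : exists Pre : {set {set 'I_m}} -> {set 'I_m} -> {set {set 'I_m}},
    forall D, D \in worm ->
    (forall e, e \in D ->
       [/\ Pre D e \in worm, symd (Pre D e) e \in worm,
           Pre D e \subset D & e \notin Pre D e])
    /\ forall h : {set {set 'I_m}} -> R,
         \sum_(e in D) (h (symd (Pre D e) e) - h (Pre D e)) = h D - h set0.
  apply: (fin_all_exists (P := fun D (P : {set 'I_m} -> {set {set 'I_m}}) =>
    D \in worm ->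
    (forall e, e \in D ->
       [/\ P e \in worm, symd (P e) e \in worm, P e \subset D & e \notin P e])
    /\ forall h : {set {set 'I_m}} -> R,
         \sum_(e in D) (h (symd (P e) e) - h (P e)) = h D - h set0)) => D.
  case: (boolP (D \in worm)) => [Dw|_]; last by exists (fun=> set0).
  by have [P hP] := canonical_order E2 R Dw; exists P.
(* The charge that the paths with difference [D] put on the transition from [A] along [e]. *)
pose trans D e A := xi D * (xprod x (e |: A) * xprod x (sdiff (e |: A) D)) * g A e.
have trans0 D e A : D \in worm -> e \in E -> A \in worm -> 0 <= trans D e A.
  move=> Dw eE Aw; have DE := Omega_worm_sub Dw; have AE := Omega_worm_sub Aw.
  have eAE : e |: A \subset E by rewrite subUset sub1set eE.
  rewrite /trans mulr_ge0 ?sqr_ge0 // mulr_ge0 // mulr_ge0 //.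
    exact/ltW/(xprod_gt0 x01).
  by apply/ltW/(xprod_gt0 x01); exact: sdiff_sub.
have step1 D : D \in worm ->
  \sum_(F in Omega0 E) xi D * xprod x (sdiff F D) * xprod x F * (f (sdiff F D) - f F) ^+ 2
  <= #|E|%:R * \sum_(e in D) \sum_(A in worm | symd A e \in worm) trans D e A.
  move=> Dw; have [P1 P2] := PreP _ Dw; have DE := Omega_worm_sub Dw.
  apply: (@le_trans _ _ (\sum_(F in Omega0 E) #|E|%:R *
     \sum_(e in D) xi D * xprod x (sdiff F D) * xprod x F * g (sdiff F (Pre D e)) e)).
    apply: ler_sum => F F0.
    have FE : F \subset E by move: F0; rewrite in_Omega0 => /andP[].
    rewrite -mulr_sumr [leRHS]mulrCA ler_wpM2l //.
      by rewrite !mulr_ge0 // ltW // (xprod_gt0 x01) // sdiff_sub.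
    rewrite -[X in f _ - f X]sdiff0 -(P2 (fun S => f (sdiff F S))).
    have := @sqr_weighted_sum_le R _ (mem D) (fun=> 1)
      (fun e => f (sdiff F (symd (Pre D e) e)) - f (sdiff F (Pre D e))) (fun _ _ => ler01).
    under eq_bigr do rewrite mul1r; move/le_trans; apply.
    rewrite sumr_const; apply: ler_pM.
    - exact: ler0n.
    - by apply: sumr_ge0 => e _; rewrite mul1r sqr_ge0.
    - by rewrite ler_nat subset_leq_card.
    rewrite le_eqVlt; apply/orP; left; apply/eqP; apply: eq_bigr => e _.
    by rewrite mul1r /g !symd_sdiff sdiffA.
  rewrite -mulr_sumr ler_wpM2l // exchange_big /=; apply: ler_sum => e eD.
  have [Pw P'w PD eP] := P1 _ eD; have eE : e \in E by apply: (subsetP DE).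
  (* For fixed [D] and [e], the start [F] and the visited state [A] determine each other; states [A]
     not coming from an even [F] only enlarge the right side. *)
  rewrite [leRHS](reindex_inj (can_inj (sdiffK (Pre D e)))) /=.
  rewrite big_mkcond [leRHS]big_mkcond /=; apply: ler_sum => F _.
  case: ifP => [F0|_]; last first.
    by case: ifP => // /andP[Aw _]; exact: trans0.
  rewrite (sdiff_Omega0_worm _ F0) Pw.
  rewrite symd_sdiff -sdiffA -symd_sdiff (sdiff_Omega0_worm _ F0) P'w /= /trans.
  rewrite le_eqVlt; apply/orP; left; apply/eqP; congr (_ * _); rewrite -mulrA; congr (_ * _).
  rewrite mulrC; apply: xprod_exchange => e' e'D; rewrite !inE.
  have -> : (e' == e) = false by apply: contraNF e'D => /eqP ->.
  have -> : (e' \in Pre D e) = false by apply: contraNF e'D; exact: (subsetP PD).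
  by rewrite addbF.
apply: le_trans (ler_sum _ step1) _; rewrite -mulr_sumr.
have -> : 2 * m%:R ^+ 3 * #|E|%:R * Z0 * dirichlet f
    = #|E|%:R * (2 * m%:R ^+ 3 * Z0 * dirichlet f) by ring.
rewrite ler_wpM2l //.
apply: (@le_trans _ _ (\sum_(D in worm) \sum_(e in E)
    \sum_(A in worm | symd A e \in worm) trans D e A)).
  apply: ler_sum => D Dw; rewrite big_mkcond [leRHS]big_mkcond /=.
  apply: ler_sum => e _; have DE := subsetP (Omega_worm_sub Dw) e.
  case: ifP => [/DE -> //|_]; case: ifP => // eE.
  by apply: sumr_ge0 => A /andP[Aw _]; exact: trans0.
(* The sum over [D] is moved innermost, to compare both sides transition by transition. *)
rewrite exchange_big /= /dirichlet [in leRHS]exchange_big /= mulr_sumr.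
apply: ler_sum => e eE; rewrite exchange_big /= mulr_sumr big_mkcondr /=.
apply: ler_sum => A Aw; have AE := Omega_worm_sub Aw.
have rhs0 : 0 <= 2 * m%:R ^+ 3 * Z0 * (wworm E x A * Pstep E x A e * (f (symd A e) - f A) ^+ 2).
  apply: mulr_ge0; first by rewrite !mulr_ge0 ?exprn_ge0 ?(ltW zpart0_gt0).
  rewrite mulr_ge0 ?sqr_ge0 // mulr_ge0 ?(Pstep_ge0 x01 _ eE) //.
  by rewrite /wworm -/(xprod x A) mulr_ge0 ?(ltW (xprod_gt0 x01 AE)) //; case: ifP.
case: ifP => // A'w.
rewrite /trans -mulr_suml.
have -> : 2 * m%:R ^+ 3 * Z0 * (wworm E x A * Pstep E x A e * (f (symd A e) - f A) ^+ 2)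
  = (2 * m%:R ^+ 3 * Z0 * (wworm E x A * Pstep E x A e)) * g A e by rewrite /g; ring.
rewrite ler_wpM2r ?sqr_ge0 //.
under eq_bigr do rewrite mulrCA.
rewrite -mulr_sumr.
have eAE : e |: A \subset E by rewrite subUset sub1set eE.
apply: le_trans (ler_wpM2l _ (flow_bound eAE)) _; first exact/ltW/(xprod_gt0 x01).
have m0 : 0 < m%:R :> R.
  have /card_gt0P[u _] : (0 < #|e|)%N by rewrite E2.
  by rewrite ltr0n (leq_ltn_trans _ (ltn_ord u)).
have -> : xprod x (e |: A) * (m%:R ^+ 2 * Z0)
    = 2 * m%:R ^+ 3 * Z0 * (xprod x (e |: A) / (2 * m%:R)).
  by field; rewrite gt_eqF.
rewrite ler_wpM2l ?(Pstep_lower E2 x01) //.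
by rewrite !mulr_ge0 ?exprn_ge0 ?(ltW zpart0_gt0).
Qed.

(** For mean-zero [f], the second moment about any constant [f F] is at least the variance;
    averaging over even [F] gives the left side of [canonical_paths]. *)
Lemma poincare (f : {set {set 'I_m}} -> R) :
  \sum_(A in worm) wworm E x A * f A = 0 ->
  \sum_(A in worm) wworm E x A * f A ^+ 2 <= 2 * m%:R ^+ 3 * #|E|%:R * dirichlet f.
Proof.
move=> f0; rewrite -(ler_pM2r zpart0_gt0).
have -> : 2 * m%:R ^+ 3 * #|E|%:R * dirichlet f * Z0
  = 2 * m%:R ^+ 3 * #|E|%:R * Z0 * dirichlet f by ring.
apply: le_trans (canonical_paths f).
rewrite exchange_big /= zpart0_Omega0 mulr_sumr; set V := \sum_(A in worm) _.
have w0 A : A \in worm -> 0 <= wworm E x A.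
  move=> /Omega_worm_sub AE.
  by rewrite /wworm -/(xprod x A) mulr_ge0 ?(ltW (xprod_gt0 x01 AE)) //; case: ifP.
apply: ler_sum => F F0.
have FE : F \subset E by move: F0; rewrite in_Omega0 => /andP[].
(* Translation by [F] permutes the worm states and preserves membership in [Omega0]. *)
have -> : \sum_(D in worm)
    (if D \in Omega0 E then m%:R else 2) * xprod x (sdiff F D) * xprod x F
       * (f (sdiff F D) - f F) ^+ 2
  = \sum_(A in worm) xprod x F * (wworm E x A * (f A - f F) ^+ 2).
  rewrite [RHS](reindex_inj (can_inj (sdiffK F))) /=; apply: eq_big => [D|D Dw].
    by rewrite (sdiffC D) sdiff_Omega0_worm.
  rewrite (sdiffC D) /wworm (sdiff_Omega0 F0 (Omega_worm_sub Dw)) -/(xprod x _).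
  by move: (if _ then _ else _) (xprod x (sdiff F D)) => a b; ring.
rewrite -mulr_sumr mulrC ler_wpM2l ?(ltW (xprod_gt0 x01 FE)) //.
have -> : \sum_(A in worm) wworm E x A * (f A - f F) ^+ 2
  = V - 2 * f F * (\sum_(A in worm) wworm E x A * f A)
    + f F ^+ 2 * \sum_(A in worm) wworm E x A.
  rewrite !mulr_sumr -sumrB -big_split /=; apply: eq_bigr => A _; ring.
rewrite f0 mulr0 subr0 lerDl mulr_ge0 ?sqr_ge0 //; exact: sumr_ge0.
Qed.

End Poincare.

(** * Variance decay and total variation *)

Section Evolution.
Variables (R : realType) (m : nat) (E : {set {set 'I_m}}).
Variable x : {set 'I_m} -> R.
Hypothesis E2 : forall e, e \in E -> #|e| = 2%N.
Hypothesis x01 : forall e, e \in E -> 0 < x e <= 1.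
Hypothesis E_gt0 : (0 < #|E|)%N.
Implicit Types (A B C S : {set {set 'I_m}}) (e : {set 'I_m}).
Implicit Types (f g h : {set {set 'I_m}} -> R).

Local Notation worm := (Omega_worm E).
Local Notation P := (Pstep E x).
Local Notation w := (wworm E x).

Definition generator h A : R := \sum_(e in E) P A e * (h (symd A e) - h A).

Lemma symd_neq A e : symd A e != A.
Proof.
apply/eqP => /setP/(_ e); rewrite symd_sdiff in_sdiff inE eqxx.
by case: (e \in A).
Qed.

(** Thus [generator] is [Pworm] minus the identity; edges leading out of the state space contribute
    0 by [Pstep_out]. *)
Lemma Pworm_apply h A : A \in worm ->
  \sum_(B in worm) Pworm E x A B * h B = h A + generator h A.
Proof.
move=> Aw; rewrite (bigD1 A) //= {1}/Pworm eqxx.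
have -> : generator h A
    = \sum_(e in E) P A e * h (symd A e) - (\sum_(e in E) P A e) * h A.
  by rewrite /generator mulr_suml -sumrB; apply: eq_bigr => e _; ring.
rewrite mulrBl mul1r addrAC [RHS]addrA -!addrA; congr (_ + _).
rewrite addrC [RHS]addrC; congr (_ + _).
transitivity (\sum_(B in worm | B != A) \sum_(e in E | B == symd A e) P A e * h B).
  apply: eq_bigr => B /andP[_ BA].
  by rewrite /Pworm eq_sym (negbTE BA) mulr_suml.
rewrite (exchange_big_dep (mem E)) /=; last by move=> B e _ /andP[].
apply: eq_bigr => e eE; case: (boolP (symd A e \in worm)) => [A'w|A'w].
  rewrite (big_pred1 (symd A e)) // => B; rewrite eE /=.
  by case: (B =P symd A e) => [->|_]; rewrite ?andbF // A'w symd_neq.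
rewrite (Pstep_out x E2) // mul0r big1 // => B /andP[/andP[Bw _] /andP[_ /eqP BA]].
by rewrite -BA Bw in A'w.
Qed.

Lemma Pworm_reversible A B : A \in worm -> B \in worm ->
  w A * Pworm E x A B = w B * Pworm E x B A.
Proof.
move=> Aw Bw; rewrite /Pworm (eq_sym B A); case: eqP => [->//|_].
have sym e : (B == symd A e) = (A == symd B e).
  by apply/eqP/eqP => ->; rewrite symdK.
rewrite !mulr_sumr; apply: eq_big => [e|e /andP[eE /eqP BA]]; first by rewrite sym.
rewrite (Pstep_reversible E2 x01) // -?BA //.
Qed.

(** By reversibility the flux along each edge is antisymmetric under [symd]. *)
Lemma generator_mean0 h : \sum_(A in worm) w A * generator h A = 0.
Proof.
rewrite /generator; under eq_bigr do rewrite mulr_sumr.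
rewrite exchange_big /= big1 // => e eE.
pose flux A := w A * (P A e * (h (symd A e) - h A)).
have restrict : \sum_(A in worm) flux A
    = \sum_(A in worm | symd A e \in worm) flux A.
  rewrite [RHS]big_mkcondr /=; apply: eq_bigr => A Aw; case: ifP => // /negbT A'w.
  by rewrite /flux (Pstep_out x E2) // mul0r mulr0.
rewrite -/(flux _) restrict; set S := \sum_(A in worm | _) _.
suff : S = - S by move=> h1; lra.
rewrite {1}/S (reindex_inj (can_inj (symdK e))) /= -sumrN.
apply: eq_big => A; first by rewrite symdK andbC.
rewrite symdK => /andP[A'w Aw].
by rewrite /flux symdK !mulrA -(Pstep_reversible E2 x01) //; ring.
Qed.

Lemma m_gt1 : (1 < m)%N.
Proof.
have /card_gt0P[e eE] := E_gt0.
by rewrite -(E2 eE) -[leqRHS]card_ord max_card.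
Qed.

Lemma wworm_gt0 A : A \in worm -> 0 < w A.
Proof.
move=> /Omega_worm_sub AE; rewrite /wworm -/(xprod x A).
rewrite mulr_gt0 ?(xprod_gt0 x01) //.
by case: ifP => // _; rewrite ltr0n ltnW // m_gt1.
Qed.

(** Twice the constant of [poincare], because one step dissipates only half of the Dirichlet
    form. *)
Local Notation K := (4 * m%:R ^+ 3 * #|E|%:R : R).

Lemma K_ge1 : 1 <= K.
Proof.
have m0 := ltnW m_gt1.
by rewrite !mulr_ege1 ?exprn_ege1 ?ler1n.
Qed.

(** The generator of the square is [2 * g A * generator g A + Q]. Cauchy-Schwarz and laziness bound
    the squared increment by half of [Q], leaving the other half as a gain. *)
Lemma generator_sqr_le g A : A \in worm ->
  (g A + generator g A) ^+ 2
  <= g A ^+ 2 + generator (fun B => g B ^+ 2) A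
     - 2^-1 * \sum_(e in E) P A e * (g (symd A e) - g A) ^+ 2.
Proof.
move=> Aw; set Q := \sum_(e in E) _.
have -> : generator (fun B => g B ^+ 2) A = 2 * g A * generator g A + Q.
  by rewrite /generator /Q mulr_sumr -big_split; apply: eq_bigr => e _ /=; ring.
have Q0 : 0 <= Q.
  by apply: sumr_ge0 => e eE; rewrite mulr_ge0 ?sqr_ge0 ?(Pstep_ge0 x01).
suff : generator g A ^+ 2 <= 2^-1 * Q.
  have -> : (g A + generator g A) ^+ 2
    = g A ^+ 2 + 2 * g A * generator g A + generator g A ^+ 2 by ring.
  by move: (generator g A ^+ 2) (2 * _ * _) => a b; lra.
apply: le_trans (sqr_weighted_sum_le _ _) _.
  by move=> e eE; exact: (Pstep_ge0 x01).
by rewrite ler_wpM2r // (Pstep_row_sum E2 x01).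
Qed.

Lemma variance_contraction g : \sum_(A in worm) w A * g A = 0 ->
  \sum_(A in worm) w A * (g A + generator g A) ^+ 2
  <= (1 - K^-1) * \sum_(A in worm) w A * g A ^+ 2.
Proof.
move=> g0; have := poincare E2 x01 g0; set V := \sum_(A in worm) _ => V_le.
have K0 : 0 < K by apply: lt_le_trans K_ge1.
apply: (@le_trans _ _ (V - 2^-1 * dirichlet E x g)).
  have -> : V - 2^-1 * dirichlet E x g
    = \sum_(A in worm) w A * (g A ^+ 2 + generator (fun B => g B ^+ 2) A
     - 2^-1 * \sum_(e in E) P A e * (g (symd A e) - g A) ^+ 2).
    rewrite -[in LHS](addr0 V) -[in LHS](generator_mean0 (fun B => g B ^+ 2)) /V /dirichlet.
    rewrite mulr_sumr -big_split -sumrB /=; apply: eq_bigr => A _.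
    rewrite mulrBr mulrDr; congr (_ - _).
    rewrite [RHS]mulrCA; congr (_ * _); rewrite mulr_sumr.
    by apply: eq_bigr => e _; rewrite -mulrA.
  by apply: ler_sum => A Aw; rewrite ler_wpM2l ?generator_sqr_le ?(ltW (wworm_gt0 Aw)).
rewrite mulrBl mul1r lerD2l lerN2 mulrC ler_pdivrMr //.
by apply: le_trans V_le _; rewrite le_eqVlt; apply/orP; left; apply/eqP; field.
Qed.

Local Notation W := (\sum_(T in worm) w T).

Lemma W_gt0 : 0 < W.
Proof.
have w0 : set0 \in worm by rewrite in_Omega_worm sub0set bd0 eqxx.
rewrite (bigD1 set0) //= ltr_wpDr ?wworm_gt0 //.
by apply: sumr_ge0 => A /andP[Aw _]; exact/ltW/wworm_gt0.
Qed.

(** The law at time t has density 1 + g with respect to [piworm], and by reversibility this density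
    evolves under [Pworm] itself. *)
Lemma density_evolution A t : A \in worm ->
  exists g, [/\ forall B, B \in worm -> Ppow E x t A B = piworm E x B * (1 + g B),
    \sum_(B in worm) w B * g B = 0
    & \sum_(B in worm) w B * g B ^+ 2 <= (1 - K^-1) ^+ t * (W ^+ 2 / w A)].
Proof.
move=> Aw; have wA := wworm_gt0 Aw; have W0 := W_gt0.
elim: t => [|t [g [g1 g2 g3]]].
  (* The density of the point mass at [A]; its variance sum is W^2 / w A - W, of which -W is
     dropped. *)
  pose d B : R := (B == A)%:R * (W / w A).
  have sum_d (c : R) : \sum_(B in worm) w B * (d B * c) = W * c.
    rewrite (bigD1 A) //= big1 ?addr0 => [|B /andP[_ /negbTE BA]].
      by rewrite /d eqxx mul1r mulrA (mulrC (w A)) divfK ?gt_eqF.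
    by rewrite /d BA !mul0r mulr0.
  exists (fun B => d B - 1); split.
  - move=> B Bw; rewrite /= /piworm addrC subrK /d (eq_sym A B).
    case: eqP => [->|_]; last by rewrite mul0r mulr0.
    by rewrite mul1r mulrA divfK ?divff // gt_eqF.
  - have := sum_d 1; rewrite mulr1 => sd.
    apply: etrans (subrr W); rewrite -[X in _ = X - _]sd -sumrB.
    by apply: eq_bigr => B _; ring.
  have dd B : d B * d B = d B * (W / w A).
    by rewrite /d; case: (B == A); rewrite /= ?mul1r ?mul0r.
  have -> : \sum_(B in worm) w B * (d B - 1) ^+ 2
    = \sum_(B in worm) w B * (d B * (W / w A - 2)) + W.
    rewrite -big_split /=; apply: eq_bigr => B _.
    have -> : (d B - 1) ^+ 2 = d B * d B - 2 * d B + 1 by ring.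
    by rewrite dd; ring.
  rewrite sum_d expr0 mul1r.
  have -> : W ^+ 2 / w A = W * (W / w A) by rewrite expr2 mulrA.
  by rewrite mulrBr; lra.
exists (fun B => g B + generator g B); split.
- move=> B Bw /=; rewrite addrA -[1 + g B + _](_ : (1 + g B) + generator (fun C => 1 + g C) B = _).
    rewrite -(Pworm_apply (fun C => 1 + g C)) // mulr_sumr; apply: eq_bigr => C Cw.
    rewrite g1 // /piworm.
    have -> : w C / W * (1 + g C) * Pworm E x C B
      = w C * Pworm E x C B * ((1 + g C) / W) by ring.
    by rewrite Pworm_reversible //; ring.
  by congr (_ + _); apply: eq_bigr => e _; ring.
- by under eq_bigr do rewrite mulrDr; rewrite big_split /= g2 generator_mean0 addr0.
apply: le_trans (variance_contraction g2) _.
rewrite [_ ^+ t.+1]exprS -[leRHS]mulrA ler_wpM2l // subr_ge0 invf_le1 ?K_ge1 //.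
by apply: lt_le_trans K_ge1.
Qed.

(** Twice the distance is the L1 norm of g under [piworm], bounded by its L2 norm. *)
Lemma tv_dist_sqr_le A t : A \in worm ->
  (2 * tv_dist E x t A) ^+ 2 <= (1 - K^-1) ^+ t * (W / w A).
Proof.
move=> Aw; have [g [g1 g2 g3]] := density_evolution t Aw; have W0 := W_gt0.
have -> : 2 * tv_dist E x t A = \sum_(B in worm) piworm E x B * `|g B|.
  rewrite /tv_dist mulrA divff ?mul1r ?pnatr_eq0 //; apply: eq_bigr => B Bw.
  rewrite g1 // mulrDr mulr1 addrC addKr normrM ger0_norm // /piworm.
  by rewrite divr_ge0 ?ltW // wworm_gt0.
apply: le_trans (sqr_weighted_sum_le _ _) _.
  by move=> B Bw; rewrite /piworm divr_ge0 ?ltW // wworm_gt0.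
rewrite /piworm -mulr_suml divff ?gt_eqF // mul1r.
under eq_bigr do rewrite real_normK ?num_real // mulrAC.
rewrite -mulr_suml ler_pdivrMr //; apply: le_trans g3 _.
by rewrite le_eqVlt; apply/orP; left; apply/eqP; rewrite expr2; ring.
Qed.

End Evolution.

(** Here [a] is m, [l] is ln(2/eps), [L] is |E| ln(2/xmin) and [v] is t/K. Since a >= 2 and l + L >=
    1, the quadratic term dominates a + 2(l + L). *)
Lemma budget (R : realFieldType) (a l L v : R) :
  2 <= a -> 2^-1 <= l -> 2^-1 <= L -> a ^+ 2 * (l + L) - 1 <= v ->
  - v + (a - 1 + L) <= - (2 * l).
Proof.
move=> a2 l2 L2; have a0 : 0 <= (a - 2) * (l + L) by rewrite mulr_ge0; lra.
have a1 : 0 <= a * ((a - 2) * (l + L)) by rewrite mulr_ge0; lra.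
have a3 : 0 <= a * (l + L - 1) by rewrite mulr_ge0; lra.
nra.
Qed.

(** * From variance decay to the mixing time *)

Section MixingTime.
Variables (R : realType) (m : nat) (E : {set {set 'I_m}}).
Variables (x : {set 'I_m} -> R) (xmin eps : R).
Hypothesis E2 : forall e, e \in E -> #|e| = 2%N.
Hypothesis x_le1 : forall e, e \in E -> x e <= 1.
Hypothesis xmin_le : forall e, e \in E -> xmin <= x e.
Hypothesis xmin_gt0 : 0 < xmin.
Hypothesis E_gt0 : (0 < #|E|)%N.
Hypothesis eps01 : 0 < eps < 1.

Let x01 e : e \in E -> 0 < x e <= 1.
Proof. by move=> eE; rewrite (lt_le_trans xmin_gt0) ?xmin_le ?x_le1. Qed.

Lemma xmin_le1 : xmin <= 1.
Proof.
by have /card_gt0P[e eE] := E_gt0; apply: le_trans (xmin_le eE) (x_le1 eE).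
Qed.

Lemma wworm_lower A : A \in Omega_worm E -> 2 * xmin ^+ #|E| <= wworm E x A.
Proof.
move=> /Omega_worm_sub AE; rewrite /wworm ler_pM // ?exprn_ge0 ?(ltW xmin_gt0) //.
  by case: ifP => // _; rewrite ler_nat (m_gt1 E2).
apply: (@le_trans _ _ (xmin ^+ #|A|)).
  by rewrite ler_wiXn2l ?(ltW xmin_gt0) ?xmin_le1 // subset_leq_card.
rewrite -prodr_const; apply: ler_prod => e eA.
by rewrite (ltW xmin_gt0) xmin_le // (subsetP AE).
Qed.

Lemma wworm_total : \sum_(A in Omega_worm E) wworm E x A <= m%:R * 2 ^+ #|E|.
Proof.
apply: (@le_trans _ _ (\sum_(A in powerset E) m%:R)); last first.
  by rewrite sumr_const card_powerset -[leLHS]mulr_natr natrX.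
rewrite big_mkcond [leRHS]big_mkcond /=; apply: ler_sum => A _; rewrite powersetE.
case: ifP => [Aw|_]; last by case: ifP.
have AE := Omega_worm_sub Aw; rewrite AE /wworm -[leRHS]mulr1 ler_pM //.
- by case: ifP.
- exact/ltW/(xprod_gt0 x01).
- by case: ifP => // _; rewrite ler_nat (m_gt1 E2).
apply: prodr_ile1 => e /(subsetP AE) eE.
by rewrite x_le1 // andbT ltW //; case/andP: (x01 eE).
Qed.

(** Equivalent to exp(-1/2) >= 1/2 at [y = 2], an instance of exp(z) >= 1 + z. *)
Lemma half_le_ln (y : R) : 2 <= y -> 2^-1 <= ln y.
Proof.
move=> y2; rewrite -ler_expR lnK ?posrE; last by lra.
have := expR_ge1Dx (- 2^-1 : R); rewrite expRN => h.
have := expR_gt0 (2^-1 : R); move: (expR 2^-1) h => z h z0.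
apply: le_trans y2; rewrite -lef_pV2 ?posrE //.
by apply: le_trans h; lra.
Qed.

(** Bounds the inverse of the least stationary probability; the factor m enters the exponent through
    m <= exp(m - 1). *)
Lemma start_bound A : A \in Omega_worm E ->
  (\sum_(T in Omega_worm E) wworm E x T) / wworm E x A
  <= expR (m%:R - 1 + #|E|%:R * ln (2 / xmin)).
Proof.
move=> Aw; rewrite ler_pdivrMr ?(wworm_gt0 E2 x01 E_gt0) //.
apply: le_trans wworm_total _.
apply: (@le_trans _ _ (expR (m%:R - 1 + #|E|%:R * ln (2 / xmin))
                       * (2 * xmin ^+ #|E|))); last first.
  by rewrite ler_wpM2l ?expR_ge0 // wworm_lower.
rewrite expRD expRM_natl lnK ?posrE ?divr_gt0 // expr_div_n.
have xN : xmin ^+ #|E| != 0 by rewrite expf_neq0 // gt_eqF.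
have -> : expR (m%:R - 1) * (2 ^+ #|E| / xmin ^+ #|E|) * (2 * xmin ^+ #|E|)
    = 2 * expR (m%:R - 1) * 2 ^+ #|E|.
  by move: (2 ^+ #|E|) (xmin ^+ #|E|) (expR _) xN => y z c z0; field.
rewrite ler_wpM2r ?exprn_ge0 //.
have := expR_ge1Dx (m%:R - 1 : R); rewrite addrC subrK => /le_trans; apply.
by rewrite ler_peMl ?expR_ge0 ?ler1n.
Qed.

Lemma worm_mixing :
  mixing_time_le E x eps
    (4 * m%:R ^+ 5 * #|E|%:R ^+ 2 * (ln (2 / eps) / #|E|%:R + ln (2 / xmin))).
Proof.
set b := (X in mixing_time_le _ _ _ X); have [eps0 eps1] := andP eps01.
have m2 : 2 <= m%:R :> R by rewrite ler_nat (m_gt1 E2).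
have N1 : 1 <= #|E|%:R :> R by rewrite ler1n.
have K1 := K_ge1 R E2 E_gt0.
set K := 4 * _ * _ in K1; have K0 : 0 < K by apply: lt_le_trans K1.
pose L := #|E|%:R * ln (2 / xmin); pose l := ln (2 / eps).
have l_ge : 2^-1 <= l by apply: half_le_ln; rewrite ler_pdivlMr //; lra.
have L_ge : 2^-1 <= L.
  have h : 2^-1 <= ln (2 / xmin).
    by apply: half_le_ln; rewrite ler_pdivlMr //; have := xmin_le1; lra.
  by apply: (le_trans h); rewrite ler_peMl //; lra.
have bE : b = K * (m%:R ^+ 2 * (l + L)).
  rewrite /b /K /L /l; move: (ln (2 / xmin)) (ln (2 / eps)) => y z; field.
  by rewrite gt_eqF //; lra.
have b0 : 0 <= b by rewrite bE !mulr_ge0 ?exprn_ge0 ?(ltW K0) //; lra.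
(* The witness is the bound rounded down. *)
have [t_le t_gt] := andP (truncn_itv b0); exists (Num.truncn b); split => //.
move=> A Aw; set t := Num.truncn b in t_gt *.
have wA := wworm_gt0 E2 x01 E_gt0 Aw.
have tv0 : 0 <= 2 * tv_dist E x t A.
  by rewrite /tv_dist !mulr_ge0 ?invr_ge0 //; exact: sumr_ge0.
suff : (2 * tv_dist E x t A) ^+ 2 <= (2 * eps) ^+ 2.
  by rewrite ler_sqr ?nnegrE ?tv0 ?mulr_ge0 ?(ltW eps0) // ler_pM2l.
apply: le_trans (tv_dist_sqr_le E2 x01 E_gt0 t Aw) _; rewrite -/K.
have decay : (1 - K^-1) ^+ t <= expR (- (t%:R / K)).
  rewrite -mulrN expRM_natl lerXn2r ?nnegrE ?expR_ge0 ?expR_ge1Dx //.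
  by rewrite subr_ge0 invf_le1.
have start := start_bound Aw; rewrite -/L in start.
apply: le_trans (ler_pM _ _ decay start) _.
- by rewrite exprn_ge0 // subr_ge0 invf_le1.
- rewrite divr_ge0 ?(ltW wA) //; apply: sumr_ge0 => B Bw.
  exact/ltW/(wworm_gt0 E2 x01 E_gt0).
(* As exp(-l) = eps/2, a factor 16 is left to spare. *)
have -> : (2 * eps) ^+ 2 = 16 * expR (- (2 * l)).
  rewrite expRN (expRM_natl 2) lnK ?posrE ?divr_gt0 //.
  by field; rewrite gt_eqF.
rewrite -expRD; apply: (@le_trans _ _ (expR (- (2 * l)))); last first.
  by rewrite ler_peMl ?expR_ge0 ?ler1n.
rewrite ler_expR.
(* Rounding loses less than 1 in t, hence at most 1 in t/K because K >= 1. *)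
have tK : m%:R ^+ 2 * (l + L) - 1 <= t%:R / K.
  rewrite ler_pdivlMr // mulrBl mul1r (mulrC _ K) -bE lerBlDr.
  by apply: le_trans (ltW t_gt) _; rewrite -natr1 lerD2l.
exact: budget m2 l_ge L_ge tK.
Qed.

End MixingTime.

(** * Application to the circuit graph *)

Lemma EC_card2 (V : finType) (mate : halfedge V -> halfedge V) (m : nat)
    (ref : 'I_m -> halfedge V) (e : {set 'I_m}) :
  e \in EC mate ref -> #|e| = 2%N.
Proof. by case/imset2P => i j _; rewrite inE => /andP[_ /andP[ij _]] ->; rewrite cards2 ij. Qed.

Lemma x_e_le1 (R : realType) (beta : R) (V : finType)
    (mate : halfedge V -> halfedge V) (m : nat) (ref : 'I_m -> halfedge V)
    (e : {set 'I_m}) :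
  0 < beta -> x_e beta mate ref e <= 1.
Proof.
move=> beta0; rewrite /x_e.
have : 0 < beta_e beta mate ref e by rewrite exprz_gt0.
by move: (beta_e _ _ _ _) => b b0; rewrite ler_pdivrMr; lra.
Qed.

Unset Implicit Arguments.

Theorem theorem7 (R : realType) (beta : R) (V : finType)
    (mate : halfedge V -> halfedge V) (m : nat) (ref : 'I_m -> halfedge V)
    (X : 'I_m -> bool) (ref' : 'I_m -> halfedge V) (eps xmin : R) :
  0 < beta -> beta != 1 ->
  four_regular_simple_connected mate ->
  circuit_enum mate ref ->
  (* X solves the relevant system over GF(2) *)
  (forall e, e \in EC mate ref -> forall u v : 'I_m, u != v -> e = [set u; v] ->
     X u (+) X v =
       (if 1 < beta then (AcntE beta mate ref e < DcntE beta mate ref e)%N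
        else (DcntE beta mate ref e < AcntE beta mate ref e)%N)) ->
  (* for X_i = 1, h_i is replaced by an adjacent half-edge of C_i *)
  (forall i : 'I_m,
     if X i then ref' i = mate (ref i) \/ ref' i = pairslot (ref i)
     else ref' i = ref i) ->
  0 < eps < 1 ->
  (0 < #|EC mate ref|)%N ->
  (* xmin = min_{e in E_C} x_e, assumed positive (otherwise the bound is +oo) *)
  (exists2 e, e \in EC mate ref & xmin = x_e beta mate ref' e) ->
  (forall e, e \in EC mate ref -> xmin <= x_e beta mate ref' e) ->
  0 < xmin ->
  mixing_time_le (EC mate ref) (x_e beta mate ref') eps
    (4 * m%:R ^+ 5 * (#|EC mate ref|)%:R ^+ 2 *
      (ln (2 / eps) / (#|EC mate ref|)%:R + ln (2 / xmin))).
Proof.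
move=> beta0 _ _ _ _ _ eps01 E_gt0 _ xmin_le xmin_gt0.
(* Positivity of the weights comes from [xmin], their upper bound 1 from [0 < beta]. *)
apply: worm_mixing => // e; first exact: EC_card2.
by move=> _; exact: x_e_le1.
Qed.
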